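(* Let $p\in[1,\infty]$, let $c>0$ and $0<\beta_1<\beta_2$ be fixed, and for each $s\in\mathbb{N}$ consider the product order-dependent weights \[ \gamma_{\mathfrak{u}}=(|\mathfrak{u}|!)^{\beta_1}\prod_{j\in\mathfrak{u}}\frac{c}{j^{\beta_2}},\qquad\mathfrak{u}\subseteq[s]. \] Let $\imath:F_{s,p,\boldsymbol{\gamma}}\hookrightarrow H_{s,p,\boldsymbol{\gamma}}$, $\imath(f)=f$, be the embedding of the anchored space into the ANOVA space. Then \[ \|\imath\|_{F_{s,p,\boldsymbol{\gamma}}\hookrightarrow H_{s,p,\boldsymbol{\gamma}}}=\Omega\left(s^\tau\right)\quad\text{as }s\to\infty,\quad\text{for all }\tau>0. \]
   Context: Notation: $[s]=\{1,\dots,s\}$, $D=[0,1]$, $D^{\mathfrak{u}}=D^{|\mathfrak{u}|}$ with coordinates indexed by $\mathfrak{u}\subseteq[s]$, $\mathfrak{u}^c=[s]\setminus\mathfrak{u}$, $\boldsymbol{x}_{\mathfrak{u}}=(x_j)_{j\in\mathfrak{u}}$; $[\boldsymbol{x}_{\mathfrak{u}};\boldsymbol{t}_{\mathfrak{u}^c}]$ has entries $x_j$ for $j\in\mathfrak{u}$ and $t_j$ for $j\notin\mathfrak{u}$. $f^{(\mathfrak{u})}=\prod_{j\in\mathfrak{u}}\frac{\partial}{\partial x_j}f$, $f^{(\emptyset)}=f$. $\boldsymbol{1}_I$ is the characteristic function of $I$. All functions are real-valued. $L_p(D^\emptyset)$ is identified with $\mathbb{R}$ with the absolute value as norm. Empty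 products equal $1$. Anchored space: $F_{s,p,\boldsymbol{\gamma}}$ is the space of functions on $D^s$ of the form $f=\sum_{\mathfrak{u}\subseteq[s]}f_{\mathfrak{u}}$ with $f_{\mathfrak{u}}(\boldsymbol{x})=\int_{D^{\mathfrak{u}}}h_{\mathfrak{u}}(\boldsymbol{t}_{\mathfrak{u}})\prod_{j\in\mathfrak{u}}\boldsymbol{1}_{[0,x_j)}(t_j)\,\mathrm{d}\boldsymbol{t}_{\mathfrak{u}}$, $h_{\mathfrak{u}}\in L_p(D^{\mathfrak{u}})$ ($f_\emptyset$ is a constant). This decomposition is unique, $h_{\mathfrak{u}}=f^{(\mathfrak{u})}([\cdot_{\mathfrak{u}};\boldsymbol{0}_{\mathfrak{u}^c}])$, and the norm is $\|f\|_{F_{s,p,\boldsymbol{\gamma}}}=\big(\sum_{\mathfrak{u}\subseteq[s]}\gamma_{\mathfrak{u}}^{-p}\|h_{\mathfrak{u}}\|_{L_p(D^{\mathfrak{u}})}^p\big)^{1/p}$. ANOVA space: $H_{s,p,\boldsymbol{\gamma}}$ is the space of functions of the form $f=\sum_{\mathfrak{u}\subseteq[s]}f_{\mathfrak{u}}$ with $f_{\mathfrak{u}}(\boldsymbol{x})=\int_{D^{\mathfrak{u}}}g_{\mathfrak{u}}(\boldsymbol{t}_{\mathfrak{u}})\prod_{j\in\mathfrak{u}}(\boldsymbol{1}_{[0,x_j)}(t_j)-(1-t_j))\,\mathrm{d}\boldsymbol{t}_{\mathfrak{u}}$, $g_{\mathfrak{u}}\in L_p(D^{\mathfrak{u}})$.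 This decomposition is unique, $g_{\mathfrak{u}}=\int_{D^{\mathfrak{u}^c}}f^{(\mathfrak{u})}([\cdot_{\mathfrak{u}};\boldsymbol{t}_{\mathfrak{u}^c}])\,\mathrm{d}\boldsymbol{t}_{\mathfrak{u}^c}$, and the norm is $\|f\|_{H_{s,p,\boldsymbol{\gamma}}}=\big(\sum_{\mathfrak{u}\subseteq[s]}\gamma_{\mathfrak{u}}^{-p}\|g_{\mathfrak{u}}\|_{L_p(D^{\mathfrak{u}})}^p\big)^{1/p}$. For $p=\infty$ the sums in the two norms are read as $\max_{\mathfrak{u}\subseteq[s]}\gamma_{\mathfrak{u}}^{-1}\|\cdot\|_{L_\infty}$. For these weights the two spaces are equal as sets of functions, so $\imath$ is well defined; $\|\imath\|$ is its operator norm. $a_s=\Omega(b_s)$ means that there is a constant $a>0$ (which may depend on $p,c,\beta_1,\beta_2,\tau$ but not on $s$) with $a_s\ge a\,b_s$ for all sufficiently large $s$. *)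

(* Defs.v *)
From HB Require Import structures.
From mathcomp Require Export all_boot all_order all_algebra.
From mathcomp Require Export interval_inference.
From mathcomp Require Export all_classical all_reals all_analysis.

Set Implicit Arguments.
Unset Strict Implicit.
Unset Printing Implicit Defensive.

Import Order.TTheory GRing.Theory Num.Theory.
Import numFieldNormedType.Exports.

Local Open Scope classical_set_scope.
Local Open Scope ring_scope.

Section cube_measure.
Variable R : realType.

Definition unit_interval_measure : set (measurableTypeR R) -> \bar R :=
  mrestr (@lebesgue_measure R) (measurable_itv `[0, 1]%R).

HB.instance Definition _ := Measure.on unit_interval_measure.

Lemma unit_interval_measureT : unit_interval_measure [set: _] = 1%E.
Proof.
by rewrite /unit_interval_measure /mrestr setTI lebesgue_measure_itv /=
  lte_fin ltr01 oppr0 adde0.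
Qed.

HB.instance Definition _ := Measure_isProbability.Build _ _ R
  unit_interval_measure unit_interval_measureT.

Definition tuple_cons n (xt : measurableTypeR R * n.-tuple (measurableTypeR R)) :
  n.+1.-tuple (measurableTypeR R) := [tuple of xt.1 :: xt.2].

Lemma measurable_tuple_cons n : measurable_fun [set: _] (@tuple_cons n).
Proof. exact: measurable_cons. Qed.

HB.instance Definition _ n := isMeasurableFun.Build _ _ _ _
  (@tuple_cons n) (@measurable_tuple_cons n).

(* Lebesgue measure on [0, 1]^n, as a probability measure on R^n carried by
   the cube; for n = 0 it is the unit mass on the empty tuple, so that L_p is
   the real line with the absolute value as norm. *)
Fixpoint cube_measure n : probability (n.-tuple (measurableTypeR R)) R :=
  match n with
  | 0 => @dirac _ _ [tuple] R
  | n.+1 => distribution (unit_interval_measure \x cube_measure n)%E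
                         (@tuple_cons n)
  end.

End cube_measure.
Arguments cube_measure {R} n.

Section anchored_anova.
Variables (R : realType) (s : nat) (p : \bar R) (gamma : {set 'I_s} -> R).
Implicit Types (u : {set 'I_s}) (x : 'I_s -> {i01 R}).
Implicit Type f : ('I_s -> {i01 R}) -> R.

(* A family (h_u) with h_u a function of the coordinates indexed by u: the i-th
   entry of the tuple is the coordinate with index enum_val i, i.e. the i-th
   element of u.  As cube_measure lives on the cube, only the values of h_u on
   [0, 1]^u matter, up to almost everywhere equality. *)
Definition term_family := forall u, #|u|.-tuple (measurableTypeR R) -> R.
Implicit Type h : term_family.

Definition Lp_family h :=
  forall u, h u \in Lfun (@cube_measure R #|u|) p.

Definition anchored_term h u x : R :=
  (\int[cube_measure #|u|]_t
    (h u t * \prod_(i < #|u|) \1_(`[0, (x (enum_val i))%:num[) (tnth t i)))%R.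

Definition anova_term h u x : R :=
  (\int[cube_measure #|u|]_t
    (h u t * \prod_(i < #|u|)
       (\1_(`[0, (x (enum_val i))%:num[) (tnth t i) - (1 - tnth t i))))%R.

Definition anchored_decomp f h :=
  Lp_family h /\ forall x, f x = \sum_u anchored_term h u x.

Definition anova_decomp f h :=
  Lp_family h /\ forall x, f x = \sum_u anova_term h u x.

Definition anchored_space : set (('I_s -> {i01 R}) -> R) :=
  [set f | exists h, anchored_decomp f h].

Definition anova_space : set (('I_s -> {i01 R}) -> R) :=
  [set f | exists h, anova_decomp f h].

(* The maximum is over nonnegative quantities, so 0 is a neutral default; the
   exponent -oo plays no role. *)
Definition weighted_norm h : \bar R :=
  match p with
  | r%:E => ((\sum_(u : {set 'I_s}) (gamma u `^ (- r))%:E *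
               'N[cube_measure #|u|]_p[EFin \o h u] `^ r) `^ r^-1)%E
  | _ => (\big[maxe/0]_(u : {set 'I_s}) (((gamma u)^-1)%:E *
               'N[cube_measure #|u|]_p[EFin \o h u]))%E
  end.

(* The decomposition of an element of the space is unique up to almost
   everywhere equality, which weighted_norm does not see, so these are the
   weighted norms of the decomposition.  The values outside the respective
   spaces are irrelevant. *)
Definition anchored_norm f : \bar R :=
  weighted_norm (xget (fun=> cst 0) [set h | anchored_decomp f h]).

Definition anova_norm f : \bar R :=
  weighted_norm (xget (fun=> cst 0) [set h | anova_decomp f h]).

Definition embedding_norm : \bar R :=
  ereal_sup [set anova_norm f |
    f in [set f | anchored_space f /\ (anchored_norm f <= 1)%E]].

End anchored_anova.

(* The element j of 'I_s stands for the index j + 1 of {1, ..., s}. *)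
Definition pod_weight (R : realType) (c beta1 beta2 : R) (s : nat)
    (u : {set 'I_s}) : R :=
  ((#|u|)`!%:R `^ beta1) * \prod_(j in u) (c / j.+1%:R `^ beta2).

(* Main.v *)
(* The test function is f = gamma_[s] * prod_j x_j, whose anchored norm is 1
   because only its component h_[s] = gamma_[s] is nonzero.  Its ANOVA component
   with index u has L_1 norm gamma_[s] / 2 ^ #|~: u|, so the norm of the embedding
   is at least 2 ^ (- #|~: u|) * gamma_[s] / gamma_u for every u.  For
   ~: u = {1, .., k} this ratio is of order (s! / (s - k)!) ^ beta1, hence of
   order s ^ (k * beta1), and k is arbitrary.
   Both decompositions are controlled by finitely supported functionals, signed
   combinations of point evaluations in each coordinate separately.  Mixed
   differences isolate the integrals of h_u over boxes anchored at 0, and by the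
   pi-lambda theorem these determine h_u almost everywhere.  Mixed differences in
   the coordinates of u combined with Riemann sums in the other coordinates
   isolate the integral of g_u up to an error vanishing with the mesh. *)
Require Import Defs.
From mathcomp Require Import measurable_realfun ess_sup_inf ring lra zify.

Set Implicit Arguments.
Unset Strict Implicit.
Unset Printing Implicit Defensive.

Import Order.TTheory GRing.Theory Num.Theory.
Import numFieldNormedType.Exports.
Local Open Scope classical_set_scope.
Local Open Scope ring_scope.

(** * Real-valued integrals *)

Section integrals.
Context d (T : measurableType d) (R : realType).
Variable mu : {measure set T -> \bar R}.

Lemma ae_eq_Rintegral (f g : T -> R) :
  measurable_fun setT f -> measurable_fun setT g ->
  {ae mu, forall x, f x = g x} -> \int[mu]_x f x = \int[mu]_x g x.
Proof.
move=> mf mg fg; rewrite /Rintegral; congr fine.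
apply: ae_eq_integral => //; try exact/measurable_EFinP.
by apply: filterS fg => x /= ->.
Qed.

(** The bound is asked almost everywhere because the ANOVA kernel is unbounded on the line and
    bounded by 1 only on the interval that carries the measure. *)
Lemma integrable_mul_ae_bounded (h g : T -> R) (M : R) :
  mu.-integrable setT (EFin \o h) -> measurable_fun setT g ->
  {ae mu, forall x, `|g x| <= M} ->
  mu.-integrable setT (EFin \o (fun x => h x * g x)).
Proof.
move=> ih mg gM; have mh : measurable_fun setT h.
  by apply/measurable_EFinP; exact: measurable_int ih.
have mhg : measurable_fun setT (EFin \o (fun x => h x * g x)).
  by apply/measurable_EFinP; exact: measurable_funM.
apply/integrableP; split => //.
have iM : mu.-integrable setT (fun x => M%:E * (EFin \o h) x)%E.
  exact: integrableZl.
have /integrableP[mM] := iM; apply: le_lt_trans.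
apply: ae_ge0_le_integral => //.
- exact: measurableT_comp.
- exact: measurableT_comp.
apply: filterS gM => x gM _ /=; rewrite !normrM !lee_fin mulrC.
by rewrite ler_wpM2r// (le_trans gM)// ler_norm.
Qed.

Lemma Rintegral_sum (I : Type) (r : seq I) (f : I -> T -> R) :
  (forall i, mu.-integrable setT (EFin \o f i)) ->
  \int[mu]_x (\sum_(i <- r) f i x) = \sum_(i <- r) \int[mu]_x f i x.
Proof.
move=> fi; elim: r => [|i r ih].
  under eq_Rintegral do rewrite big_nil.
  by rewrite big_nil Rintegral_cst// mul0r.
under eq_Rintegral do rewrite big_cons.
rewrite big_cons RintegralD ?ih//.
rewrite (_ : _ \o _ = fun x => \sum_(i <- r) (f i x)%:E)%E.
  by apply: (integrable_sum measurableT) => i0 _; exact: fi.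
by apply/funext => x /=; rewrite sumEFin.
Qed.

End integrals.

(** * L_p norms on a probability space *)

Section Lnorm_probability.
Context d (T : measurableType d) (R : realType).
Variable P : probability T R.
Implicit Types (p : \bar R) (f : T -> R).

Lemma eq_ae_Lnorm p f g : (1 <= p)%E ->
  measurable_fun setT f -> measurable_fun setT g ->
  {ae P, forall x, f x = g x} ->
  ('N[P]_p[EFin \o f] = 'N[P]_p[EFin \o g])%E.
Proof.
move=> p1 mf mg fg; rewrite unlock; case: p p1 => [r r1| |//].
  congr (_ `^ _)%E; apply: ae_eq_integral => //.
  - apply: (@measurableT_comp _ _ _ _ _ _ (fun x => x `^ r)%E) => //=.
      exact: measurable_poweR.
    by apply/measurable_EFinP; exact: measurableT_comp.
  - apply: (@measurableT_comp _ _ _ _ _ _ (fun x => x `^ r)%E) => //=.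
      exact: measurable_poweR.
    by apply/measurable_EFinP; exact: measurableT_comp.
  by apply: filterS fg => x /= ->.
move=> _; case: ifP => // _; apply: eq_ess_sup.
by apply: filterS fg => x /= ->.
Qed.

Lemma Lnorm_cst p (c : R) : (1 <= p)%E ->
  ('N[P]_p[EFin \o (fun=> c)] = `|c|%:E)%E.
Proof.
move=> p1; rewrite unlock; case: p p1 => [r r1| _|//].
  have r0 : (r != 0)%R by rewrite gt_eqF// (lt_le_trans ltr01).
  under eq_integral do rewrite /= .
  rewrite integral_cst// [X in (_ * X)%E](@probability_setT _ _ _ P) mule1.
  by rewrite poweR_EFin -powRrM mulfV// powRr1.
rewrite [X in (0 < X)%E](@probability_setT _ _ _ P) lte01; apply: ess_sup_ae_cst.
  by rewrite [X in (0 < X)%E](@probability_setT _ _ _ P) lte01.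
exact: nearW.
Qed.

Lemma Lfun_cst_ge1 p (c : R) : (1 <= p)%E -> (fun=> c) \in Lfun P p.
Proof.
move=> p1; rewrite inE; apply/andP; split; rewrite inE//=.
by rewrite /finite_norm Lnorm_cst// ltry.
Qed.

Lemma Lfun_mfun p f : f \in Lfun P p -> measurable_fun setT f.
Proof. by case/andP; rewrite !inE. Qed.

Lemma Lfun_integrable1 p f : (1 <= p)%E -> f \in Lfun P p ->
  P.-integrable setT (EFin \o f).
Proof.
move=> p1 fp; apply/Lfun1_integrable.
apply: (@Lfun_subset _ _ _ P 1 p) => //.
by rewrite [X in X \is a _](@probability_setT _ _ _ P).
Qed.

(** For finite p > 1 this is Hölder against the constant 1, whose dual norm is 1 because the total
    mass is 1; for p = oo the essential supremum is integrated. *)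
Lemma Lnorm1_le p f : (1 <= p)%E -> measurable_fun setT f ->
  ('N[P]_1[EFin \o f] <= 'N[P]_p[EFin \o f])%E.
Proof.
move=> p1 mf; case: p p1 => [r||//].
  rewrite lee_fin le_eqVlt => /predU1P[<-//|r1].
  have r0 : 0 < r by rewrite (lt_trans ltr01).
  have q0 : 0 < (1 - r^-1)^-1 by rewrite invr_gt0 subr_gt0 invf_lt1.
  have := @hoelder _ _ _ P f (fun=> 1) r (1 - r^-1)^-1 mf
    (@measurable_cst _ _ _ _ _ _) r0 q0.
  rewrite invrK addrC subrK => /(_ erefl).
  rewrite Lnorm_cst ?normr1 ?mule1; last first.
    by rewrite lee_fin invf_ge1 ?subr_gt0 ?invf_lt1// gerBl invr_ge0 ltW.
  by under [in leLHS]eq_Lnorm do rewrite /= mulr1.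
move=> _; rewrite Lnorm1 unlock [X in (0 < X)%E](@probability_setT _ _ _ P) lte01.
rewrite -[leRHS]mule1 -[X in (_ * X)%E](@probability_setT _ _ _ P).
apply: integral_le_bound => //.
- exact/measurable_EFinP.
- apply: ess_sup_gee; first by rewrite [X in (0 < X)%E](@probability_setT _ _ _ P) lte01.
  by apply: nearW => x; exact: abse_ge0.
by apply: filterS (ess_sup_ge P (abse \o (EFin \o f))) => x + _.
Qed.

End Lnorm_probability.

(** * Fubini for products of functions of separate variables *)

Section tensor.
Context d1 d2 (T1 : measurableType d1) (T2 : measurableType d2) (R : realType).
Variables (m1 : probability T1 R) (m2 : probability T2 R).
Variables (a : T1 -> R) (b : T2 -> R).
Hypotheses (ia : m1.-integrable setT (EFin \o a))
  (ib : m2.-integrable setT (EFin \o b)).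

Lemma integrable_tensor :
  (m1 \x m2)%E.-integrable setT (EFin \o (fun z => a z.1 * b z.2)).
Proof.
have ma : measurable_fun setT a by apply/measurable_EFinP; case/integrableP: ia.
have mb : measurable_fun setT b by apply/measurable_EFinP; case/integrableP: ib.
apply/integrable12ltyP.
  apply/measurable_EFinP; apply: measurable_funM.
    exact: (measurableT_comp ma measurable_fst).
  exact: (measurableT_comp mb measurable_snd).
under eq_integral => x _.
  under eq_integral do rewrite /= normrM EFinM.
  rewrite ge0_integralZl_EFin//; last first.
    by apply/measurable_EFinP; exact: measurableT_comp.
  over.
have /integrableP[_ /= foo] := ib.
have /integrableP[_ /= aoo] := ia.
have fb : (\int[m2]_x `|b x|%:E)%E \is a fin_num.
  by rewrite ge0_fin_numE// integral_ge0.
rewrite -(fineK fb) ge0_integralZr//.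
- by rewrite lte_mul_pinfty ?ge0_fin_numE ?integral_ge0 ?ltry.
- by apply/measurable_EFinP; exact: measurableT_comp.
- by rewrite lee_fin fine_ge0// integral_ge0.
Qed.

Lemma Rintegral_tensor :
  \int[(m1 \x m2)%E]_z (a z.1 * b z.2) = (\int[m1]_x a x) * (\int[m2]_y b y).
Proof.
rewrite -RintegralZr// {1}/Rintegral -(integral12_prod_meas1 integrable_tensor).
rewrite /fubini_F /=; congr fine; apply: eq_integral => x _.
rewrite [in RHS]EFinM /Rintegral fineK; last exact: integrable_fin_num.
by rewrite -integralZl.
Qed.

End tensor.

(** * Product integrands on the unit cube *)

Section cube.
Variable R : realType.
Local Notation U := (@unit_interval_measure R).
Implicit Types n : nat.

(** Integrability and the value are proved in one induction, since Fubini for head times tail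
    requires the tail product to be integrable. *)
Lemma cube_tensor n (k : 'I_n -> measurableTypeR R -> R) :
  (forall i, U.-integrable setT (EFin \o k i)) ->
  (cube_measure n).-integrable setT
    (EFin \o (fun t => \prod_(i < n) k i (tnth t i))) /\
  \int[cube_measure n]_t (\prod_(i < n) k i (tnth t i)) =
    \prod_(i < n) \int[U]_t k i t.
Proof.
elim: n k => [|n ih] k ik.
  split.
    rewrite (_ : _ \o _ = EFin \o (fun=> 1)).
      exact: finite_measure_integrable_cst.
    by apply/funext => t /=; rewrite big_ord0.
  under eq_Rintegral do rewrite big_ord0.
  by rewrite Rintegral_cst// big_ord0 mul1r
    [X in fine X](@probability_setT _ _ _ (cube_measure 0)).
have [ib eb] := ih (fun i => k (lift ord0 i)) (fun i => ik (lift ord0 i)).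
have FE (f : 'I_n.+1 -> measurableTypeR R -> R) z :
    \prod_(i < n.+1) f i (tnth (tuple_cons z) i) =
    f ord0 z.1 * \prod_(i < n) f (lift ord0 i) (tnth z.2 i).
  by rewrite big_ord_recl; congr (_ * _); apply: eq_bigr => i _; rewrite tnthS.
have iF := integrable_tensor (ik ord0) ib.
have mk : measurable_fun setT
    (fun t : n.+1.-tuple (measurableTypeR R) => (\prod_(i < n.+1) k i (tnth t i))%:E).
  apply/measurable_EFinP; apply: measurable_prod => i _.
  apply: (measurableT_comp (f := k i)); last exact: measurable_tnth.
  by apply/measurable_EFinP; case/integrableP: (ik i).
have ikF : (U \x cube_measure n)%E.-integrable (@tuple_cons R n @^-1` setT)
    ((fun t : n.+1.-tuple _ => (\prod_(i < n.+1) k i (tnth t i))%:E) \o @tuple_cons R n).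
  rewrite preimage_setT; apply: eq_integrable iF => // z _ /=.
  by rewrite FE.
split.
  exact: (integrable_pushforward (@measurable_tuple_cons R n) mk ikF).
rewrite big_ord_recl -eb -Rintegral_tensor//.
rewrite /Rintegral; congr fine.
rewrite [LHS](integral_pushforward (@measurable_tuple_cons R n) mk ikF)//.
by rewrite preimage_setT; apply: eq_integral => z _ /=; rewrite FE.
Qed.

Lemma unit_measure_indic (A : set (measurableTypeR R)) : measurable A ->
  \int[U]_t \1_A t = fine (U A).
Proof. by move=> mA; rewrite /Rintegral integral_indic// setIT. Qed.

Lemma unit_measure_co (x : {i01 R}) : U `[0, x%:num[ = (x%:num)%:E.
Proof.
have x0 : 0 <= x%:num by [].
have x1 : x%:num <= 1 by [].
rewrite /unit_interval_measure /mrestr setIidl; last first.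
  by move=> t /=; rewrite !in_itv /= => /andP[-> /ltW/le_trans]; apply.
rewrite lebesgue_measure_itv /= lte_fin sube0.
by case: ifPn => // ; rewrite -leNgt => xle0; congr EFin; apply/eqP; rewrite eq_le x0.
Qed.

(** The endpoint 1 is dropped so that the indicator of [[0, 1[], the anchored kernel at x = 1,
    equals 1 at every remaining point. *)
Lemma ae_unit_measure : {ae U, forall t, t \in `[0, 1[%R}.
Proof.
exists (~` `[0, 1[); split => //.
  exact: measurableC.
rewrite /unit_interval_measure /mrestr setIC -setDE.
rewrite (_ : _ `\` _ = [set 1]) ?lebesgue_measure_set1//.
apply/seteqP; split => [t /=|t /= ->]; rewrite !in_itv /=; last first.
  by rewrite ler01 lexx ltxx; split.
by move=> [/andP[-> t1] /negP]; rewrite -leNgt => ?; apply/eqP; rewrite eq_le t1.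
Qed.

Lemma ae_cube n :
  {ae @cube_measure R n, forall t : n.-tuple (measurableTypeR R),
     forall i, tnth t i \in `[0, 1[%R}.
Proof.
apply: filter_forall => i.
pose A : set (measurableTypeR R) := ~` `[0, 1[.
have mA : measurable A by exact: measurableC.
have mAi : measurable ((fun t : n.-tuple (measurableTypeR R) => tnth t i) @^-1` A).
  by rewrite -[X in measurable X]setTI; apply: measurable_tnth.
exists ((fun t : n.-tuple (measurableTypeR R) => tnth t i) @^-1` A); split => //.
have U0 : U A = 0%E.
  have [B [mB B0 AB]] := ae_unit_measure.
  by apply: (subset_measure0 _ _ _ B0) => //.
(* The indicator of the cylinder over A is a product with trivial factors off i, so its integral is
   a product containing the factor [U A], which is 0. *)
pose k j : measurableTypeR R -> R := if j == i then \1_A else cst 1.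
have ik j : U.-integrable setT (EFin \o k j).
  rewrite /k; case: ifP => _; first exact: integrable_indic.
  exact: finite_measure_integrable_cst.
have [_] := cube_tensor ik.
rewrite [RHS](bigD1 i)//= {2}/k eqxx unit_measure_indic// U0 mul0r.
under eq_Rintegral => t _.
  rewrite (bigD1 i)//= big1 ?mulr1 => [|j /negPf ji]; last by rewrite /k ji.
  rewrite /k eqxx.
  rewrite (_ : \1_A (tnth t i) =
    \1_((fun t : n.-tuple (measurableTypeR R) => tnth t i) @^-1` A) t)//.
  over.
rewrite /Rintegral integral_indic// setIT => h.
by rewrite -[LHS]fineK ?h// fin_num_measure.
Qed.

End cube.

(** * Integrals over anchored boxes determine a function on the cube *)

Section boxes.
Variables (R : realType) (n : nat).
Local Notation Rn := (n.-tuple (measurableTypeR R)).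

Definition box (J : 'I_n -> set (measurableTypeR R)) : set Rn :=
  [set t | forall i, J i (tnth t i)].

(** Rays generate the Borel sets of the whole line, which the intervals from 0 inside [0, 1] do not.
    The full line is included so that a box may constrain a single coordinate and the whole space is
    itself a box. *)
Definition lower_ray : set (set (measurableTypeR R)) :=
  [set A | A = setT \/ exists y, A = `]-oo, y[%classic].

Definition lower_boxes : set (set Rn) :=
  [set B | exists2 J, (forall i, lower_ray (J i)) & B = box J].

Lemma measurable_lower_ray A : lower_ray A -> measurable A.
Proof. by move=> [->|[y ->]]; [exact: measurableT|exact: measurable_itv]. Qed.

Lemma measurable_box J : (forall i, measurable (J i)) -> measurable (box J).
Proof.
move=> mJ; rewrite (_ : box J =
    \bigcap_(i in [set: 'I_n]) ((fun t : Rn => tnth t i) @^-1` J i)).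
  apply: fin_bigcap_measurable => // i _.
  by rewrite -[X in measurable X]setTI; apply: measurable_tnth.
by apply/seteqP; split=> t /= Jt i; [move=> _|]; exact: Jt.
Qed.

Lemma lower_boxes_setI : setI_closed lower_boxes.
Proof.
move=> _ _ [J KJ ->] [L KL ->]; exists (fun i => J i `&` L i).
  move=> i; case: (KJ i) => [->|[y ->]]; first by rewrite setTI; exact: KL.
  case: (KL i) => [->|[z ->]]; first by rewrite setIT; right; exists y.
  right; exists (Num.min y z); apply/seteqP; split=> t /=;
    by rewrite !in_itv/= lt_min => /andP.
apply/seteqP; split=> t /=; first by move=> [Jt Lt] i; split.
by move=> JLt; split=> i; case: (JLt i).
Qed.

Lemma lower_boxesT : lower_boxes setT.
Proof.
by exists (fun=> setT) => [i|]; [left|apply/seteqP; split].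
Qed.

Lemma measurable_lower_boxes : @measurable _ Rn = <<s lower_boxes >>.
Proof.
apply/seteqP; split; last first.
  apply: smallest_sub; first exact: sigma_algebra_measurable.
  by move=> _ [J KJ ->]; apply: measurable_box => i; exact: measurable_lower_ray.
apply: smallest_sub; first exact: smallest_sigma_algebra.
move=> B; rewrite -bigcup_seq/= => -[i _ [A mA <-{B}]]; rewrite setTI.
have mR := RGenInftyO.measurableE R.
have : <<s @RGenInftyO.G R >> A by rewrite -[X in X A]mR.
(* Good sets principle: the sets whose cylinder in direction i is generated by the boxes form a
   sigma-algebra, and it contains the open lower rays. *)
pose H : set (set (measurableTypeR R)) :=
  [set C | <<s lower_boxes >> ((fun t : Rn => tnth t i) @^-1` C)].
suff : <<s @RGenInftyO.G R >> `<=` H by move=> /(_ A).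
have [s0 sC sU] := smallest_sigma_algebra setT lower_boxes.
apply: smallest_sub; first split.
- by rewrite /H /= preimage_set0.
- by move=> C; rewrite /H /= => /sC; rewrite !setTD preimage_setC.
- by move=> F HF; rewrite /H /= preimage_bigcup; exact: sU.
move=> _ [y ->]; apply: sub_sigma_algebra.
exists (fun j => if j == i then `]-oo, y[%classic else setT).
  by move=> j; case: ifP => _; [right; exists y|left].
apply/seteqP; split=> t /=; first by move=> ty j; case: eqP => [->|].
by move=> /(_ i); rewrite eqxx.
Qed.

Lemma lower_ray_unit A : lower_ray A ->
  exists x : {i01 R}, forall t, t \in `[0, 1[%R ->
    (\1_A t = \1_(`[0, x%:num[) t :> R).
Proof.
move=> [->|[y ->]].
  exists (Itv01 ler01 (lexx 1)) => t t01 /=; rewrite !indicE; congr (nat_of_bool _)%:R.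
  by rewrite in_setT; apply/esym; rewrite mem_setE.
(* The endpoint y is clamped to [0, 1], which changes no comparison t < y with t in [0, 1[. *)
have h0 : 0 <= Num.min 1 (Num.max 0 y) by rewrite le_min ler01 le_max lexx.
have h1 : Num.min 1 (Num.max 0 y) <= 1 by rewrite ge_min lexx.
exists (Itv01 h0 h1) => t; rewrite in_itv/= => /andP[t0 t1].
rewrite !indicE; congr (nat_of_bool _)%:R.
by rewrite !mem_setE !in_itv /= t0 lt_min t1 lt_max ltNge t0.
Qed.

(** Up to a null set a lower box meets the cube in a box anchored at 0, so the integral of f
    vanishes on a pi-system generating the measurable sets. Dynkin's theorem extends this to all
    measurable sets, which forces f = 0 almost everywhere. *)
Lemma cube_box_unique (f : Rn -> R) :
  (cube_measure n).-integrable setT (EFin \o f) ->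
  (forall x : 'I_n -> {i01 R}, \int[cube_measure n]_t
     (f t * \prod_(i < n) \1_(`[0, (x i)%:num[) (tnth t i)) = 0) ->
  {ae cube_measure n, forall t, f t = 0}.
Proof.
move=> fi f0.
have mf : measurable_fun setT f by apply/measurable_EFinP; case/integrableP: fi.
have fiS S : measurable S -> (cube_measure n).-integrable S (EFin \o f).
  by move=> mS; apply: integrableS fi.
have box0 B : lower_boxes B -> (\int[cube_measure n]_(t in B) (f t)%:E = 0)%E.
  move=> [J KJ ->{B}].
  have mJ : measurable (box J).
    by apply: measurable_box => i; exact: measurable_lower_ray.
  have /choice[x xP] := fun i => lower_ray_unit (KJ i).
  rewrite -[LHS]fineK; last by apply: integrable_fin_num => //; exact: fiS.
  congr EFin; rewrite -[RHS](f0 x).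
  rewrite -[LHS]/(Rintegral _ _ _) Rintegral_mkcond.
  apply: ae_eq_Rintegral.
  - apply/measurable_EFinP; rewrite -restrict_EFin.
    by apply/(measurable_restrictT _ mJ); apply: measurable_funTS; exact/measurable_EFinP.
  - apply: measurable_funM => //; apply: measurable_prod => i _.
    apply: (@measurableT_comp _ _ _ _ _ _ (\1_(`[0, (x i)%:num[) :
      measurableTypeR R -> R)); last exact: measurable_tnth.
    by apply: measurable_indic; exact: measurable_itv.
  apply: filterS (ae_cube R n) => t t01.
  under eq_bigr do rewrite -xP//.
  rewrite patchE; case: ifPn => [|].
    rewrite inE => Jt; rewrite big1 ?mulr1// => i _.
    by rewrite indicE mem_set//; exact: Jt.
  rewrite notin_setE => /existsNP[i Jti].
  by rewrite (bigD1 i)//= indicE memNset// mul0r mulr0.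
have all0 B : measurable B -> (\int[cube_measure n]_(t in B) (f t)%:E = 0)%E.
  rewrite measurable_lower_boxes.
  apply: (dynkin_induction (P := fun C => \int[cube_measure n]_(t in C) (f t)%:E = 0)%E
    measurable_lower_boxes lower_boxes_setI).
  - exact/box0/lower_boxesT.
  - by move=> C; exact: box0.
  - move=> C mC C0; have := box0 _ lower_boxesT.
    rewrite -(setUv C) integral_setU ?C0 ?add0e//.
    + exact: measurableC.
    + by rewrite setUv; exact/measurable_EFinP.
    + by apply/disj_setPS; rewrite setICr.
  - move=> F mF tF F0; rewrite integral_bigcup//; last first.
      by apply: fiS; exact: bigcupT_measurable.
    by apply: eseries0 => k _ _; exact: F0.
have := @integral_ae_eq _ _ R (cube_measure n) setT measurableT (cst 0%E) _ fi.
move=> /(_ (@measurable_cst _ _ _ _ _ _)) [E _ mE|N [mN N0 sN]].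
  by rewrite [LHS]all0// integral0.
exists N; split => // t /= ft; apply: sN => /= h; apply: ft.
by have /= [] := h I.
Qed.

End boxes.

(** * Tensor functionals acting on integrals against product kernels *)

Lemma normr_Rintegral_mul_le d (T : measurableType d) (R : realType)
    (mu : {measure set T -> \bar R}) (h g : T -> R) (M : R) : 0 <= M ->
  mu.-integrable setT (EFin \o h) -> measurable_fun setT g ->
  {ae mu, forall x, `|g x| <= M} ->
  `|\int[mu]_x (h x * g x)| <= M * \int[mu]_x `|h x|.
Proof.
move=> M0 ih mg gM; have ihg := integrable_mul_ae_bounded ih mg gM.
have inh : mu.-integrable setT (EFin \o (fun x => `|h x|)) := integrable_norm ih.
rewrite (le_trans (le_normr_Rintegral measurableT ihg))// -RintegralZl//.
rewrite /Rintegral fine_le//.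
- by apply: integrable_fin_num => //; exact: (integrable_norm ihg).
- by apply: integrable_fin_num => //; exact: (integrableZl measurableT M inh).
apply: ae_ge0_le_integral => //.
- by case/integrableP: (integrable_norm ihg).
- by move=> x _; rewrite lee_fin mulr_ge0.
- by case/integrableP: (integrableZl measurableT M inh).
apply: filterS gM => x gM _ /=.
by rewrite normrM lee_fin mulrC ler_wpM2r.
Qed.

Section kernel.
Variables (R : realType) (s : nat).
Variable K : {i01 R} -> measurableTypeR R -> R.
Hypothesis mK : forall x, measurable_fun setT (K x).
Hypothesis K_le1 : forall x t, t \in `[0, 1[%R -> `|K x t| <= 1.
Implicit Types (h : term_family R s) (u : {set 'I_s}) (x : 'I_s -> {i01 R}).

(** Abstracting the kernel treats both spaces at once: [anchored_term] and [anova_term] are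
    instances of it up to unfolding. *)
Definition kernel_term h u x : R :=
  \int[cube_measure #|u|]_t
    (h u t * \prod_(i < #|u|) K (x (enum_val i)) (tnth t i)).

Lemma measurable_prod_tnth n (k : 'I_n -> measurableTypeR R -> R) :
  (forall i, measurable_fun setT (k i)) ->
  measurable_fun [set: n.-tuple (measurableTypeR R)]
    (fun t => \prod_(i < n) k i (tnth t i)).
Proof.
move=> mk; apply: measurable_prod => i _.
exact: (measurableT_comp (mk i) (measurable_tnth _)).
Qed.

Lemma integrable_kernel_term h u x :
  (cube_measure #|u|).-integrable setT (EFin \o h u) ->
  (cube_measure #|u|).-integrable setT (EFin \o
    (fun t => h u t * \prod_(i < #|u|) K (x (enum_val i)) (tnth t i))).
Proof.
move=> hi; apply: (@integrable_mul_ae_bounded _ _ _ _ _ _ 1) => //.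
  exact: (measurable_prod_tnth (k := fun i => K (x (enum_val i)))).
apply: filterS (ae_cube R #|u|) => t t01.
by rewrite normr_prod prodr_ile1// => i _; rewrite normr_ge0 K_le1.
Qed.

(** Indexing the factors by j in u, rather than by tuple positions, lets them be merged with factors
    for the coordinates outside u. For j in u the default 0 of [nth] is never reached. *)
Lemma prod_enum_val_nth (f : 'I_s -> R -> R) u (t : #|u|.-tuple R) :
  \prod_(i < #|u|) f (enum_val i) (tnth t i) =
  \prod_(j in u) f j (nth 0 t (index j (enum u))).
Proof.
rewrite [RHS]big_enum_val; apply: eq_bigr => i _; congr (f _ _).
rewrite (tnth_nth 0) (enum_val_nth (enum_val i)) index_uniq ?enum_uniq//.
by rewrite -cardE.
Qed.

(** The functional is a tensor product of weighted point evaluations, one for each coordinate. By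
    distributivity it acts factor by factor: a coordinate outside u sees a constant and contributes
    its total weight, a coordinate in u acts on the kernel under the integral. *)
Lemma kernel_functional (T : finType) (w : 'I_s -> T -> R)
    (pts : 'I_s -> T -> {i01 R}) h u :
  (cube_measure #|u|).-integrable setT (EFin \o h u) ->
  \sum_(k : {ffun 'I_s -> T}) (\prod_j w j (k j)) *
      kernel_term h u (fun j => pts j (k j)) =
  (\prod_(j | j \notin u) \sum_a w j a) *
    \int[cube_measure #|u|]_t (h u t * \prod_(i < #|u|)
       \sum_a w (enum_val i) a * K (pts (enum_val i) a) (tnth t i)).
Proof.
move=> hi.
have hk (k : {ffun 'I_s -> T}) := integrable_kernel_term (fun j => pts j (k j)) hi.
have pointwise (t : #|u|.-tuple (measurableTypeR R)) :
  \sum_(k : {ffun 'I_s -> T}) (\prod_j w j (k j)) *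
    (h u t * \prod_(i < #|u|) K (pts (enum_val i) (k (enum_val i))) (tnth t i)) =
  (h u t * \prod_(i < #|u|)
       \sum_a w (enum_val i) a * K (pts (enum_val i) a) (tnth t i)) *
  (\prod_(j | j \notin u) \sum_a w j a).
  rewrite (prod_enum_val_nth (fun j y => \sum_a w j a * K (pts j a) y)).
  pose F j a := w j a *
    (if j \in u then K (pts j a) (nth 0 t (index j (enum u))) else 1).
  rewrite -mulrA [X in _ * X](_ : _ = \prod_j \sum_a F j a); last first.
    rewrite [RHS](bigID (mem u))/=; congr (_ * _); apply: eq_bigr => j.
      by move=> ju; apply: eq_bigr => a _; rewrite /F ju.
    by move=> /negPf ju; apply: eq_bigr => a _; rewrite /F ju mulr1.
  rewrite bigA_distr_bigA mulr_sumr; apply: eq_bigr => k _.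
  rewrite (prod_enum_val_nth (fun j y => K (pts j (k j)) y)) mulrCA; congr (_ * _).
  by rewrite big_split/= -big_mkcond.
have hZ (k : {ffun 'I_s -> T}) : (\prod_j w j (k j)) *
      kernel_term h u (fun j => pts j (k j)) =
    \int[cube_measure #|u|]_t ((\prod_j w j (k j)) *
      (h u t * \prod_(i < #|u|) K (pts (enum_val i) (k (enum_val i))) (tnth t i))).
  by rewrite RintegralZl//; exact: hk.
rewrite (eq_bigr _ (fun k _ => hZ k)).
rewrite -Rintegral_sum => [|k]; last exact: (integrableZl measurableT _ (hk k)).
under eq_Rintegral do rewrite pointwise.
rewrite mulrC RintegralZr//.
have mbd j a : measurable_fun setT (fun t => w j a * K (pts j a) t).
  by apply: measurable_funM => //; exact: measurable_cst.
(* As the kernel is at most 1 on the cube, the absolute weights bound each factor. *)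
pose B := \prod_(i < #|u|) \sum_a `|w (enum_val i) a|.
apply: (@integrable_mul_ae_bounded _ _ _ _ _ _ B) => //.
  by apply: (measurable_prod_tnth (k := fun i t =>
    \sum_a w (enum_val i) a * K (pts (enum_val i) a) t)) => i; exact: measurable_sum.
apply: filterS (ae_cube R #|u|) => t t01.
rewrite normr_prod ler_prod// => i _; rewrite normr_ge0/=.
rewrite (le_trans (ler_norm_sum _ _ _))// ler_sum// => a _.
by rewrite normrM ler_piMr// K_le1.
Qed.

End kernel.

Lemma product_functional (R : realType) s (T : finType) (w : 'I_s -> T -> R)
    (pts : 'I_s -> T -> R) (c : R) :
  \sum_(k : {ffun 'I_s -> T}) (\prod_j w j (k j)) * (c * \prod_j pts j (k j)) =
  c * \prod_j \sum_a w j a * pts j a.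
Proof.
rewrite bigA_distr_bigA mulr_sumr; apply: eq_bigr => k _.
by rewrite mulrCA big_split.
Qed.

(** * The anchored and the ANOVA kernel *)

Section kernels.
Variable R : realType.

Definition anchored_kernel (x : {i01 R}) (t : measurableTypeR R) : R :=
  \1_(`[0, x%:num[) t.

Definition anova_kernel (x : {i01 R}) (t : measurableTypeR R) : R :=
  \1_(`[0, x%:num[) t - (1 - t).

Lemma measurable_anchored_kernel x : measurable_fun setT (anchored_kernel x).
Proof. by apply: measurable_indic; exact: measurable_itv. Qed.

Lemma measurable_anova_kernel x : measurable_fun setT (anova_kernel x).
Proof.
apply: measurable_funB; first exact: measurable_anchored_kernel.
by apply: measurable_funB => //; exact: measurable_cst.
Qed.

Lemma anchored_kernel_le1 x t : `|anchored_kernel x t| <= 1.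
Proof. by rewrite /anchored_kernel indicE; case: (_ \in _); rewrite ?normr1 ?normr0. Qed.

Lemma anova_kernel_le1 x t : t \in `[0, 1[%R -> `|anova_kernel x t| <= 1.
Proof.
rewrite in_itv/= /anova_kernel indicE => /andP[t0 t1].
by case: (_ \in _); rewrite /= ler_norml; apply/andP; split; lra.
Qed.

Definition i01_0 : {i01 R} := Itv01 (lexx 0) ler01.

Lemma anchored_kernel0 t : anchored_kernel i01_0 t = 0.
Proof.
rewrite /anchored_kernel indicE memNset//= in_itv/=.
by move=> /andP[t0 /(le_lt_trans t0)]; rewrite ltxx.
Qed.

Lemma Rintegral_anchored_kernel x :
  \int[@unit_interval_measure R]_t anchored_kernel x t = x%:num.
Proof.
rewrite [LHS]unit_measure_indic; last exact: measurable_itv.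
by rewrite unit_measure_co.
Qed.

Lemma integrable_unit_bounded (g : measurableTypeR R -> R) :
  measurable_fun setT g -> (forall t, t \in `[0, 1[%R -> `|g t| <= 1) ->
  (@unit_interval_measure R).-integrable setT (EFin \o g).
Proof.
move=> mg g1.
have i1 : (@unit_interval_measure R).-integrable setT (EFin \o (fun=> 1)).
  exact: finite_measure_integrable_cst.
have := @integrable_mul_ae_bounded _ _ _ _ _ _ 1 i1 mg.
under [X in integrable _ _ (EFin \o X)]eq_fun do rewrite mul1r.
apply; apply: (@filterS _ _ (ae_filter_ringOfSetsType _) _ _ _
  (ae_unit_measure R)) => t; exact: g1.
Qed.

(* Its value 1 / 2 is never needed: x - unit_mean and unit_mean add up to x. *)
Definition unit_mean : R := \int[@unit_interval_measure R]_t (1 - t).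

Lemma Rintegral_anova_kernel x :
  \int[@unit_interval_measure R]_t anova_kernel x t = x%:num - unit_mean.
Proof.
rewrite /anova_kernel RintegralB//.
- by rewrite -[in RHS]Rintegral_anchored_kernel.
- apply: integrable_unit_bounded; first exact: measurable_anchored_kernel.
  by move=> t _; exact: anchored_kernel_le1.
- apply: integrable_unit_bounded.
    by apply: measurable_funB => //; exact: measurable_cst.
  by move=> t; rewrite in_itv/= => /andP[t0 t1];
    rewrite ler_norml; apply/andP; split; lra.
Qed.

End kernels.

(** * Uniqueness of the anchored decomposition *)

Section anchored_uniqueness.
Variables (R : realType) (s : nat).
Implicit Types (h : term_family R s) (u : {set 'I_s}) (x : 'I_s -> {i01 R}).

Let integrable_family h := forall u,
  (cube_measure #|u|).-integrable setT (EFin \o h u).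

(* The functional is the product over j \in u of the differences
   f |-> f(x_j) - f(0) and over j \notin u of the evaluations at 0.  It kills the
   components v that do not contain u, since the weights sum to 0 for j \in u, and
   those not contained in u, since the kernel vanishes at 0. *)
Lemma anchored_mixed_difference u x h : integrable_family h ->
  \sum_(k : {ffun 'I_s -> bool})
     (\prod_j (if k j then (j \in u)%:R else (-1) ^+ (j \in u))) *
     \sum_v anchored_term h v (fun j => if k j then x j else i01_0 R) =
  \int[cube_measure #|u|]_t (h u t *
     \prod_(i < #|u|) \1_(`[0, (x (enum_val i))%:num[) (tnth t i)).
Proof.
move=> hi; under eq_bigr do rewrite mulr_sumr.
pose w (j : 'I_s) (b : bool) : R := if b then (j \in u)%:R else (-1) ^+ (j \in u).
pose pts (j : 'I_s) (b : bool) := if b then x j else i01_0 R.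
have mK := @measurable_anchored_kernel R.
have K1 (y : {i01 R}) (t : R) (_ : t \in `[0, 1[%R) := anchored_kernel_le1 y t.
have wsum j : \sum_a w j a = (j \notin u)%:R.
  by rewrite big_bool /w; case: (j \in u); rewrite /= ?expr1 ?subrr// expr0 add0r.
have wK j t : \sum_a w j a * anchored_kernel (pts j a) t =
    (j \in u)%:R * anchored_kernel (x j) t.
  by rewrite big_bool /w /pts /= anchored_kernel0 mulr0 addr0.
rewrite exchange_big (bigD1 u)//= [X in _ + X]big1 ?addr0 => [|v vu].
  rewrite [LHS](kernel_functional mK K1 w pts)// big1 ?mul1r => [|j ju].
    apply: eq_Rintegral => t _; congr (_ * _); apply: eq_bigr => i _.
    by rewrite wK enum_valP mul1r.
  by rewrite wsum ju.
rewrite [LHS](kernel_functional mK K1 w pts)//.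
have [uv|] := boolP (u \subset v); last first.
  move=> /subsetPn[j ju jv]; rewrite (bigD1 j)//= wsum ju mul0r.
  by rewrite mul0r.
have /subsetPn[j jv ju] : ~~ (v \subset u).
  by apply: contraNN vu => vu; rewrite finset.eqEsubset vu.
have ij : enum_val (enum_rank_in jv j) = j by rewrite enum_rankK_in.
under eq_Rintegral => t _.
  rewrite (bigD1 (enum_rank_in jv j))//= wK ij (negPf ju) !mul0r mulr0.
  over.
by rewrite Rintegral_cst// mul0r mulr0.
Qed.

(** The mixed difference depends only on the represented function, so [h u] and [h' u] have the same
    integrals over all boxes anchored at 0. *)
Lemma anchored_unique h h' : integrable_family h -> integrable_family h' ->
  (forall x, \sum_u anchored_term h u x = \sum_u anchored_term h' u x) ->
  forall u, {ae cube_measure #|u|, forall t, h u t = h' u t}.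
Proof.
move=> hi hi' hh' u.
have mh (g : term_family R s) : integrable_family g -> measurable_fun setT (g u).
  by move=> gi; apply/measurable_EFinP; case/integrableP: (gi u).
have di : (cube_measure #|u|).-integrable setT (EFin \o (fun t => h u t - h' u t)).
  rewrite (_ : _ \o _ = (EFin \o h u) \- (EFin \o h' u))%E.
    exact: integrableB.
  by apply/funext.
suff : {ae cube_measure #|u|, forall t, h u t - h' u t = 0}.
  by apply: filterS => t /eqP; rewrite subr_eq0 => /eqP.
apply: cube_box_unique => // x.
(* The corner x, indexed by positions in u, is extended by 0 to a point of the full cube. *)
pose X (j : 'I_s) : {i01 R} :=
  if [pick i | enum_val i == j] is Some i then x i else i01_0 R.
have XE i : X (enum_val i) = x i.
  rewrite /X; case: pickP => [i' /eqP/enum_val_inj -> //|/(_ i)].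
  by rewrite eqxx.
pose B (t : #|u|.-tuple (measurableTypeR R)) :=
  \prod_(i < #|u|) anchored_kernel (X (enum_val i)) (tnth t i).
have iB (g : term_family R s) : integrable_family g ->
    (cube_measure #|u|).-integrable setT (EFin \o (fun t => g u t * B t)).
  move=> gi; apply: integrable_kernel_term => //.
    exact: measurable_anchored_kernel.
  by move=> *; exact: anchored_kernel_le1.
transitivity (\int[cube_measure #|u|]_t (h u t * B t - h' u t * B t)).
  apply: eq_Rintegral => t _; rewrite -mulrBl; congr (_ * _).
  by apply: eq_bigr => i _; rewrite XE.
rewrite RintegralB//; try exact: iB.
rewrite -[X in X - _]anchored_mixed_difference//.
rewrite -[X in _ - X]anchored_mixed_difference//.
apply/eqP; rewrite subr_eq0; apply/eqP.
by apply: eq_bigr => k _; rewrite hh'.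
Qed.

End anchored_uniqueness.

(** * Differences and Riemann sums applied to ANOVA components *)

Section anova_functional.
Variables (R : realType) (s N : nat).
Implicit Types (h : term_family R s) (u v : {set 'I_s}).

Lemma grid_ge0 (a : 'I_N.+2) : 0 <= a%:R / N.+1%:R :> R.
Proof. by rewrite divr_ge0. Qed.

Lemma grid_le1 (a : 'I_N.+2) : a%:R / N.+1%:R <= 1 :> R.
Proof. by rewrite ler_pdivrMr// mul1r ler_nat -ltnS. Qed.

(** There are N + 2 points for N + 1 cells, so that both endpoints 0 and 1 belong to the grid and
    the mesh is defined for every N. *)
Definition grid (a : 'I_N.+2) : {i01 R} := Itv01 (grid_ge0 a) (grid_le1 a).

(* The endpoint difference f(1) - f(0) for j \in u, and the right-endpoint Riemann
   sum with mesh 1 / N.+1 for j \notin u. *)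
Definition anova_weight u (j : 'I_s) (a : 'I_N.+2) : R :=
  if j \in u then (a == ord_max)%:R - (a == ord0)%:R
  else (a != ord0)%:R / N.+1%:R.

Lemma anova_weight_in u j (F : 'I_N.+2 -> R) : j \in u ->
  \sum_a anova_weight u j a * F a = F ord_max - F ord0.
Proof.
move=> ju; rewrite /anova_weight ju.
under eq_bigr do rewrite mulrBl.
rewrite sumrB (bigD1 ord_max)//= eqxx mul1r big1 ?addr0 => [|i /negPf ->]; last first.
  by rewrite mul0r.
rewrite (bigD1 ord0)//= ?eqxx ?mul1r [X in _ - (_ + X)]big1 ?addr0// => i /negPf ->.
by rewrite mul0r.
Qed.

Lemma anova_weight_notin u j (F : 'I_N.+2 -> R) : j \notin u ->
  \sum_a anova_weight u j a * F a = N.+1%:R^-1 * \sum_(a < N.+1) F (lift ord0 a).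
Proof.
move=> /negPf ju; rewrite /anova_weight ju big_ord_recl/= mul0r mul0r add0r mulr_sumr.
by apply: eq_bigr => a _; rewrite mul1r.
Qed.

(** For fixed t the ANOVA kernel has integral 0 in x, because 1 - t is the integral of the indicator
    of t < x. The right-endpoint sum of this monotone indicator errs by at most one mesh width. *)
Lemma riemann_indicator (t : R) : t \in `[0, 1[%R ->
  `|N.+1%:R^-1 * \sum_(a < N.+1) anova_kernel (grid (lift ord0 a)) t| <= N.+1%:R^-1.
Proof.
rewrite in_itv/= => /andP[t0 t1].
set e := N.+1%:R^-1; have e0 : 0 < e by rewrite invr_gt0.
have eN : N.+1%:R * e = 1 by rewrite mulfV.
(* Induction on the number of cells: the partial sum up to m e lies between max(0, m e - t) and that
   value plus e, with exact value 0 before t is passed. *)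
have E m : (m%:R * e <= t -> \sum_(a < m) ((t < a.+1%:R * e)%R%:R : R) * e = 0) /\
   (t < m%:R * e -> m%:R * e - t <= \sum_(a < m) ((t < a.+1%:R * e)%R%:R : R) * e
        <= m%:R * e - t + e).
  elim: m => [|m [ih1 ih2]].
    by rewrite big_ord0; split => //; rewrite mul0r ltNge t0.
  rewrite big_ord_recr/= -natr1 mulrDl mul1r; split=> [mt|tm].
    rewrite ih1 ?add0r; last by lra.
    by rewrite ltNge mt mul0r.
  rewrite tm mul1r.
  have [mt|mt] := leP (m%:R * e) t; first by rewrite (ih1 mt); lra.
  by have := ih2 mt; lra.
have SE : \sum_(a < N.+1) ((t < a.+1%:R * e)%R%:R : R) * e =
    e * (\sum_(a < N.+1) anova_kernel (grid (lift ord0 a)) t) + (1 - t).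
  have -> : 1 - t = e * \sum_(a < N.+1) (1 - t).
    by rewrite sumr_const card_ord -mulr_natl mulrA (mulrC e) eN mul1r.
  rewrite -mulr_suml [LHS]mulrC -mulrDr; congr (_ * _).
  rewrite -big_split/=; apply: eq_bigr => a _.
  by rewrite /anova_kernel indicE mem_setE in_itv/= t0/= /bump/= add1n subrK.
have [_] := E N.+1; rewrite eN SE => /(_ t1) h.
by rewrite ler_norml; lra.
Qed.

(** On component u the endpoint differences turn every kernel into 1, leaving the integral of [h u].
    A component v missing some j in u is killed, as the weights at j sum to 0. If v strictly
    contains u, a coordinate in v but not in u contributes a Riemann sum of size at most 1 / (N +
    1), and all other factors are at most 1. *)
Lemma anova_functional_le u h :
  (forall v, (cube_measure #|v|).-integrable setT (EFin \o h v)) ->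
  `|\sum_(k : {ffun 'I_s -> 'I_N.+2}) (\prod_j anova_weight u j (k j)) *
      \sum_v anova_term h v (fun j => grid (k j))| <=
  \int[cube_measure #|u|]_t `|h u t| +
  N.+1%:R^-1 * \sum_(v | v != u) \int[cube_measure #|v|]_t `|h v t|.
Proof.
move=> hi; under eq_bigr do rewrite mulr_sumr.
rewrite exchange_big/= (bigD1 u)//=.
have mK := @measurable_anova_kernel R.
have K1 := @anova_kernel_le1 R.
pose kn j (t : measurableTypeR R) := \sum_a anova_weight u j a * anova_kernel (grid a) t.
have eps_ge0 : 0 <= N.+1%:R^-1 :> R by rewrite invr_ge0.
have eps_le1 : N.+1%:R^-1 <= 1 :> R by rewrite invf_le1// ler1n.
have mkn j : measurable_fun setT (kn j).
  by apply: measurable_sum => a; apply: measurable_funM => //; exact: measurable_cst.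
have mpkn v : measurable_fun [set: #|v|.-tuple (measurableTypeR R)]
    (fun t => \prod_(i < #|v|) kn (enum_val i) (tnth t i)).
  exact: (measurable_prod_tnth (k := fun i => kn (enum_val i))).
have kn_notin j t : j \notin u -> t \in `[0, 1[%R -> `|kn j t| <= N.+1%:R^-1.
  by move=> ju t01; rewrite /kn anova_weight_notin// riemann_indicator.
have kn_in j t : j \in u -> t \in `[0, 1[%R -> kn j t = 1.
  move=> ju t01; rewrite /kn anova_weight_in// /anova_kernel !indicE !mem_setE.
  move: t01; rewrite !in_itv/= => /andP[t0 t1].
  by rewrite mulfV// t0 t1/= mul0r (ltNge t) t0/=; lra.
have kn_le1 j t : t \in `[0, 1[%R -> `|kn j t| <= 1.
  move=> t01; have [ju|ju] := boolP (j \in u); first by rewrite kn_in// normr1.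
  exact: le_trans (kn_notin _ _ ju t01) eps_le1.
have wsum j : \sum_a anova_weight u j a = (j \notin u)%:R.
  under eq_bigr do rewrite -[anova_weight _ _ _]mulr1.
  have [ju|ju] := boolP (j \in u); first by rewrite anova_weight_in// subrr.
  by rewrite anova_weight_notin// sumr_const card_ord -mulr_natl mulr1 mulVf.
rewrite (le_trans (ler_normD _ _))// lerD//.
  rewrite [X in `|X|](kernel_functional mK K1 (anova_weight u) (fun=> grid))//.
  rewrite big1 ?mul1r => [|j ju]; last by rewrite wsum ju.
  rewrite -[leRHS]mul1r normr_Rintegral_mul_le//; first exact: mpkn.
  apply: filterS (ae_cube R #|u|) => t t01.
  by rewrite normr_prod prodr_ile1// => i _; rewrite normr_ge0 kn_le1.
rewrite (le_trans (ler_norm_sum _ _ _))// mulr_sumr ler_sum// => v vu.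
rewrite [X in `|X|](kernel_functional mK K1 (anova_weight u) (fun=> grid))//.
have [uv|] := boolP (u \subset v); last first.
  move=> /subsetPn[j ju jv]; rewrite (bigD1 j)//= wsum ju mul0r mul0r normr0.
  by rewrite mulr_ge0// Rintegral_ge0.
have /subsetPn[j jv ju] : ~~ (v \subset u).
  by apply: contraNN vu => vu; rewrite finset.eqEsubset vu.
rewrite big1 ?mul1r => [|j' j'v]; last first.
  by rewrite wsum (contra (fintype.subsetP uv j')).
apply: normr_Rintegral_mul_le => //; first exact: mpkn.
apply: filterS (ae_cube R #|v|) => t t01.
rewrite normr_prod (bigD1 (enum_rank_in jv j))//= enum_rankK_in//.
rewrite -[leRHS]mulr1 ler_pM//.
- by apply: prodr_ge0.
- exact: kn_notin.
by rewrite prodr_ile1// => i _; rewrite normr_ge0 kn_le1.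
Qed.

(** The endpoint difference of x is 1, and its right-endpoint sum is 1/2 + 1/(2(N + 1)). Right
    endpoints overestimate, so the lower bound carries no error term. *)
Lemma anova_functional_product u (c : R) : 0 <= c ->
  c * 2^-1 ^+ #|~: u| <=
  \sum_(k : {ffun 'I_s -> 'I_N.+2}) (\prod_j anova_weight u j (k j)) *
     (c * \prod_j (grid (k j))%:num).
Proof.
move=> c0; rewrite (product_functional _ (fun _ a => (grid a)%:num)) ler_wpM2l//.
rewrite (bigID (mem u))/= big1 ?mul1r => [|j ju]; last first.
  by rewrite anova_weight_in//= mul0r subr0 mulfV.
rewrite -prodr_const (eq_bigl (fun j => j \notin u)) => [|j]; last by rewrite inE.
apply: ler_prod => j ju; rewrite invr_ge0 ler0n/= anova_weight_notin//=.
under eq_bigr do rewrite /bump/= add1n.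
rewrite -mulr_suml.
have S m : (\sum_(a < m) a.+1%:R : R) = m%:R * (m%:R + 1) / 2.
  by elim: m => [|m ih]; rewrite ?big_ord0 ?mul0r// big_ord_recr/= ih -natr1; field.
rewrite S; have n0 : N.+1%:R != 0 :> R by rewrite pnatr_eq0.
rewrite (_ : _ * _ = 2^-1 + 2^-1 * N.+1%:R^-1); last by field.
by rewrite lerDl mulr_ge0.
Qed.

End anova_functional.

(** * Both decompositions of the test function *)

Section monomial.
Variables (R : realType) (s : nat) (c : R).
Implicit Types (u : {set 'I_s}) (x : 'I_s -> {i01 R}).

Lemma kernel_term_cst (K : {i01 R} -> measurableTypeR R -> R) u x (a : R) :
  (forall y, (@unit_interval_measure R).-integrable setT (EFin \o K y)) ->
  \int[cube_measure #|u|]_t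
    (a * \prod_(i < #|u|) K (x (enum_val i)) (tnth t i)) =
  a * \prod_(j in u) \int[@unit_interval_measure R]_t K (x j) t.
Proof.
move=> iK.
have [iP eP] := cube_tensor (fun i => iK (x (@enum_val _ (mem u) i))).
by rewrite RintegralZl// eP [in RHS]big_enum_val.
Qed.

Definition anchored_monomial : term_family R s :=
  fun u _ => if u == [set: 'I_s]%SET then c else 0.

Definition anova_monomial : term_family R s :=
  fun u _ => c * unit_mean R ^+ #|~: u|.

Lemma anchored_decomp_monomial (p : \bar R) : (1 <= p)%E ->
  anchored_decomp p (fun x => c * \prod_j (x j)%:num) anchored_monomial.
Proof.
move=> p1; split=> [u|x]; first exact: Lfun_cst_ge1.
have iK (y : {i01 R}) := integrable_unit_bounded (@measurable_anchored_kernel R y)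
  (fun t _ => anchored_kernel_le1 y t).
have E u := kernel_term_cst u x (if u == [set: 'I_s]%SET then c else 0) iK.
rewrite (eq_bigr _ (fun u _ => E u)) (bigD1 [set: 'I_s]%SET)//= eqxx.
rewrite [X in _ + X]big1 => [|u /negPf ->]; last by rewrite mul0r.
rewrite addr0; congr (_ * _); apply: eq_big => [j|j _]; first by rewrite inE.
by rewrite Rintegral_anchored_kernel.
Qed.

(** Each x_j is split as (x_j - m) + m with m the [unit_mean], and the product is expanded over
    subsets; x_j - m is the integral of the ANOVA kernel. This provides the existence that makes
    [xget] return a genuine decomposition. *)
Lemma anova_decomp_monomial (p : \bar R) : (1 <= p)%E ->
  anova_decomp p (fun x => c * \prod_j (x j)%:num) anova_monomial.
Proof.
move=> p1; split=> [u|x]; first exact: Lfun_cst_ge1.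
have iK (y : {i01 R}) := integrable_unit_bounded (@measurable_anova_kernel R y)
  (@anova_kernel_le1 R y).
have E u := kernel_term_cst u x (c * unit_mean R ^+ #|~: u|) iK.
rewrite (eq_bigr _ (fun u _ => E u)).
under eq_bigr do rewrite -[(x _)%:num](subrK (unit_mean R)).
rewrite bigA_distr mulr_sumr; apply: eq_bigr => u _.
rewrite -mulrA [_ * \prod_(j in u) _]mulrC; congr (_ * _).
rewrite (bigID (mem u))/=; congr (_ * _).
  by apply: eq_bigr => j ju; rewrite ju Rintegral_anova_kernel.
rewrite -prodr_const; apply: eq_big => [j|j /negPf ->//]; first by rewrite inE.
Qed.

End monomial.

(** * Elementary bounds on the weighted norm *)

Section weighted_norm.
Variables (R : realType) (s : nat) (p : \bar R) (gamma : {set 'I_s} -> R).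
Hypothesis p1 : (1 <= p)%E.
Hypothesis gamma_gt0 : forall u, 0 < gamma u.
Implicit Types (h : term_family R s) (u : {set 'I_s}).

Lemma weighted_norm_ge h u :
  (((gamma u)^-1)%:E * 'N[cube_measure #|u|]_p[EFin \o h u] <=
   weighted_norm p gamma h)%E.
Proof.
case: p p1 => [r r1|_|//]; last first.
  exact: (le_bigmax _ (fun u => ((gamma u)^-1)%:E *
               'N[cube_measure #|u|]_+oo[EFin \o h u])%E).
have r0 : 0 < r by rewrite (lt_le_trans ltr01).
have gi : 0 <= (gamma u)^-1 by rewrite invr_ge0 ltW.
rewrite /weighted_norm.
set X := (X in (X <= _)%E).
have X0 : (0 <= X)%E by rewrite mule_ge0 ?lee_fin ?Lnorm_ge0.
(* In this form monotonicity of the r-th root reduces the claim to comparing one summand with the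
   sum. *)
have -> : X = ((X `^ r) `^ r^-1)%E by rewrite -poweRrM mulfV ?gt_eqF// poweRe1.
rewrite gt0_ler_poweR//.
- by rewrite invr_ge0 ltW.
- by rewrite in_itv/= poweR_ge0 leey.
- rewrite in_itv/= leey andbT; apply: sume_ge0 => v _.
  by rewrite mule_ge0 ?poweR_ge0// lee_fin powR_ge0.
rewrite (bigD1 u)//= [X in (_ <= X + _)%E](_ : _ = X `^ r)%E.
  rewrite leeDl//; apply: sume_ge0 => v _.
  by rewrite mule_ge0 ?poweR_ge0// lee_fin powR_ge0.
rewrite /X poweRM ?lee_fin ?Lnorm_ge0// poweR_EFin; congr (_%:E * _)%E.
by rewrite -powR_inv1 ?ltW// -powRrM mulN1r.
Qed.

Lemma weighted_norm_top h :
  'N[cube_measure #|[set: 'I_s]%SET|]_p[EFin \o h [set: 'I_s]%SET]%E =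
    (gamma [set: 'I_s]%SET)%:E ->
  (forall u, u != [set: 'I_s]%SET -> 'N[cube_measure #|u|]_p[EFin \o h u]%E = 0%E) ->
  (weighted_norm p gamma h <= 1)%E.
Proof.
case: p p1 => [r r1|_|//] hT h0; last first.
  rewrite /weighted_norm; apply: bigmax_le => // u _.
  have [->|uT] := eqVneq u [set: 'I_s]%SET; last by rewrite h0// mule0.
  by rewrite hT -EFinM mulVf// gt_eqF.
have r0 : 0 < r by rewrite (lt_le_trans ltr01).
rewrite /weighted_norm (bigD1 [set: 'I_s]%SET)//= hT.
rewrite [X in (_ + X)%E]big1 => [|u uT]; last first.
  by rewrite h0// poweR0r ?gt_eqF// mule0.
rewrite adde0 poweR_EFin -EFinM powRN mulVf ?gt_eqF ?powR_gt0//.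
by rewrite poweR1r.
Qed.

End weighted_norm.

(** * Lower bound for the embedding norm with general weights *)

Section embedding.
Variables (R : realType) (s : nat) (p : \bar R) (gamma : {set 'I_s} -> R).
Hypothesis p1 : (1 <= p)%E.
Hypothesis gamma_gt0 : forall u, 0 < gamma u.
Let top := [set: 'I_s]%SET.
Let f (x : 'I_s -> {i01 R}) : R := gamma top * \prod_j (x j)%:num.

(** The norm is computed on the decomposition selected by [xget]; uniqueness identifies it almost
    everywhere with the explicit one. *)
Lemma anchored_norm_monomial : (anchored_norm p gamma f <= 1)%E.
Proof.
rewrite /anchored_norm; set h := xget _ _.
have mono := anchored_decomp_monomial s (gamma top) p1.
have [hL hf] : anchored_decomp p f h.
  by apply: (xgetPex _ (P := [set h | anchored_decomp p f h])); exists (@anchored_monomial R s (gamma top)).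
have [mL mf] := mono.
have hm (u : {set 'I_s}) : {ae cube_measure #|u|, forall t : #|u|.-tuple (measurableTypeR R),
    h u t = @anchored_monomial R s (gamma top) u t}.
  move: u; apply: anchored_unique.
  - by move=> u; apply: Lfun_integrable1 (hL u).
  - by move=> u; apply: Lfun_integrable1 (mL u).
  - by move=> x; rewrite -hf -mf.
have hN (u : {set 'I_s}) : ('N[cube_measure #|u|]_p[EFin \o h u] =
    `|if u == top then gamma top else 0|%:E)%E.
  rewrite (eq_ae_Lnorm p1 _ _ (hm u)) ?Lnorm_cst//.
    exact: Lfun_mfun (hL u).
  exact: Lfun_mfun (mL u).
apply: weighted_norm_top => // [|u /negPf uT]; rewrite hN.
  by rewrite eqxx ger0_norm// ltW.
by rewrite uT normr0.
Qed.

(** The functional is evaluated on f in two ways, through the product formula and through g. As g is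
    arbitrary, the bound applies to the decomposition that [xget] selects. *)
Lemma anova_component_ge u (g : term_family R s) : anova_decomp p f g ->
  gamma top * 2^-1 ^+ #|~: u| <= \int[cube_measure #|u|]_t `|g u t|.
Proof.
move=> [gL gf].
have gi (v : {set 'I_s}) : (cube_measure #|v|).-integrable setT (EFin \o g v).
  exact: Lfun_integrable1 (gL v).
set B := \sum_(v | v != u) \int[cube_measure #|v|]_t `|g v t|.
have B0 : 0 <= B by apply: sumr_ge0 => v _; exact: Rintegral_ge0.
apply/ler_addgt0Pr => e e0.
(* The mesh is so fine that the other components contribute at most e. *)
pose N := Num.truncn (B / e).
have BN : N.+1%:R^-1 * B <= e.
  rewrite mulrC ler_pdivrMr// mulrC -ler_pdivrMr//.
  by rewrite ltW// truncnS_gt.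
rewrite (le_trans (anova_functional_product N u (ltW (gamma_gt0 top))))//.
have := anova_functional_le N u gi; under eq_bigr do rewrite -gf.
move=> /(le_trans (ler_norm _))/le_trans; apply.
by rewrite lerD2l.
Qed.

Lemma embedding_norm_ge u :
  ((gamma top * 2^-1 ^+ #|~: u| / gamma u)%:E <= embedding_norm p gamma)%E.
Proof.
apply: (@le_trans _ _ (anova_norm p gamma f)); last first.
  apply: ereal_sup_ubound; exists f => //; split; last exact: anchored_norm_monomial.
  exists (@anchored_monomial R s (gamma top)); exact: anchored_decomp_monomial.
rewrite /anova_norm; set g := xget _ _.
have gf : anova_decomp p f g.
  apply: (xgetPex _ (P := [set h | anova_decomp p f h])).
  by exists (@anova_monomial R s (gamma top)); exact: anova_decomp_monomial.
(* Only the term at u is kept, and its L_p norm is then lowered to the L_1 norm. *)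
apply: le_trans (weighted_norm_ge p1 gamma_gt0 g u).
rewrite mulrC EFinM lee_pmul2l ?lte_fin ?invr_gt0//.
apply: (@le_trans _ _ ('N[cube_measure #|u|]_1[EFin \o g u])%E); last first.
  exact: Lnorm1_le p1 (Lfun_mfun (gf.1 u)).
rewrite Lnorm1; under eq_integral do rewrite abse_EFin.
have iu : (cube_measure #|u|).-integrable setT (EFin \o (fun t => `|g u t|)).
  apply: integrable_norm; exact: Lfun_integrable1 (gf.1 u).
rewrite -[leRHS]fineK ?lee_fin; first exact: anova_component_ge.
exact: integrable_fin_num iu.
Qed.

End embedding.

(** * Growth of the product order-dependent weight ratio *)

Section pod_weights.
Variables (R : realType) (c beta1 beta2 : R).
Hypotheses (c0 : 0 < c) (b0 : 0 < beta1).
Local Notation gamma s := (@pod_weight R c beta1 beta2 s).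

Lemma pod_weight_gt0 s (u : {set 'I_s}) : 0 < gamma s u.
Proof.
rewrite mulr_gt0 ?powR_gt0 ?ltr0n ?fact_gt0//.
by apply: prodr_gt0 => j _; rewrite divr_gt0 ?powR_gt0.
Qed.

Lemma expn_le_ffact s k : (k <= s)%N -> ((s - k) ^ k <= s ^_ k)%N.
Proof.
move=> ks; rewrite ffact_prod -[X in (_ ^ X)%N]card_ord -prod_nat_const.
by apply: leq_prod => i _; rewrite leq_sub2l// ltnW.
Qed.

(** Removing the first k indices leaves a ratio equal to (s! / (s - k)!) ^ beta1 times k weight
    factors independent of s. The falling factorial is at least (s - k) ^ k, hence at least (s / 2)
    ^ k when 2k <= s. *)
Lemma pod_weight_ratio k s : (0 < s)%N -> (k.*2 <= s)%N ->
  exists2 u : {set 'I_s}, #|~: u| = k &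
    (2^-1 `^ (k%:R * beta1) * \prod_(j < k) (c / j.+1%:R `^ beta2)) *
      s%:R `^ (k%:R * beta1) <= gamma s [set: 'I_s]%SET / gamma s u.
Proof.
move=> s0 ks; have ks' : (k <= s)%N by lia.
pose u := [set j : 'I_s | (k <= j)%N]%SET.
have uC : #|~: u| = k.
  rewrite -sum1_card (eq_bigl (fun j : 'I_s => (j < k)%N)) => [|j]; last first.
    by rewrite !inE ltnNge.
  by rewrite -(big_ord_widen s (fun=> 1%N))// sum1_card card_ord.
have uE : #|u| = (s - k)%N by rewrite -[s in RHS]card_ord -(cardsC u) uC addnK.
exists u => //.
rewrite /pod_weight cardsT card_ord uE.
pose F j : R := c / j.+1%:R `^ beta2.
have F0 j : 0 < F j by rewrite divr_gt0 ?powR_gt0.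
have -> : \prod_(j in [set: 'I_s]%SET) (c / j.+1%:R `^ beta2) =
    \prod_(j in u) (c / j.+1%:R `^ beta2) * \prod_(j < k) (c / j.+1%:R `^ beta2).
  under eq_bigl do rewrite inE.
  rewrite (bigID (mem u))/=; congr (_ * _).
  rewrite (eq_bigl (fun j : 'I_s => (j < k)%N)) => [|j]; last by rewrite inE ltnNge.
  by rewrite -(big_ord_widen s F).
set A := \prod_(j in u) _; set P := \prod_(j < k) _.
have A0 : 0 < A by apply: prodr_gt0 => j _; exact: F0.
have P0 : 0 < P by apply: prodr_gt0 => j _; exact: F0.
have q0 : 0 < (s - k)`!%:R `^ beta1 :> R by apply: powR_gt0; rewrite ltr0n fact_gt0.
rewrite [leRHS](_ : _ = s`!%:R `^ beta1 / (s - k)`!%:R `^ beta1 * P); last first.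
  by field; rewrite !gt_eqF.
rewrite mulrAC (ler_wpM2r (ltW P0))// ler_pdivlMr//.
rewrite -powRM// !powRrM powR_mulrn ?mulr_ge0// -powRM ?exprn_ge0 ?mulr_ge0//.
rewrite (ge0_ler_powR (ltW b0)) ?nnegrE ?mulr_ge0 ?exprn_ge0 ?mulr_ge0//.
rewrite -(ffact_fact ks') natrM ler_wpM2r//.
apply: (@le_trans _ _ ((s - k) ^ k)%:R); last by rewrite ler_nat expn_le_ffact.
rewrite natrX lerXn2r ?nnegrE ?mulr_ge0//.
rewrite mulrC ler_pdivrMr// -natrM ler_nat; lia.
Qed.

End pod_weights.

(** * Superpolynomial growth of the embedding norm *)

Theorem proposition8 (R : realType) (p : \bar R) (c beta1 beta2 : R)
    (hp : (1 <= p)%E) (hc : 0 < c) (hb1 : 0 < beta1) (hb12 : beta1 < beta2) :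
  forall tau : R, 0 < tau ->
    exists2 a : R, 0 < a &
      \forall s \near \oo,
        ((a * s%:R `^ tau)%:E <=
           embedding_norm p (@pod_weight R c beta1 beta2 s))%E.
Proof.
(* With this k the exponent k * beta1 exceeds [tau]. *)
move=> tau tau0; pose k := (Num.truncn (tau / beta1)).+1.
have tauk : tau <= k%:R * beta1 by rewrite -ler_pdivrMr// ltW// truncnS_gt.
pose b := 2^-1 `^ (k%:R * beta1) * \prod_(j < k) (c / j.+1%:R `^ beta2).
have b0 : 0 < b.
  rewrite mulr_gt0 ?powR_gt0//; apply: prodr_gt0 => j _.
  by rewrite divr_gt0 ?powR_gt0.
(* [b] comes from the weight ratio, the power of 1/2 from the k coordinates outside u. *)
exists (b * 2^-1 ^+ k); first by rewrite mulr_gt0// exprn_gt0.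
(* As k is a successor, s >= 2k also gives s >= 1, which the comparison of powers of s at the end
   requires. *)
exists k.*2 => // s /= ks.
have s0 : (0 < s)%N by rewrite (leq_trans _ ks).
have [u uk bu] := pod_weight_ratio beta2 hc hb1 s0 ks.
apply: le_trans (embedding_norm_ge hp (@pod_weight_gt0 _ _ beta1 beta2 hc s) u).
rewrite lee_fin uk mulrAC [leRHS]mulrAC ler_wpM2r ?exprn_ge0//.
apply: le_trans bu; rewrite (ler_wpM2l (ltW b0))//.
by apply: ler_powR => //; rewrite ler1n.
Qed.
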